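(* Let $(I_n)_{n\in\mathbb{N}}$ be a $\operatorname{Sym}$-invariant chain of squarefree monomial ideals $I_n\subseteq R_n$ and fix an integer $j\ge 0$. Then the number $f_j(n)^{\operatorname{Sym}}$ of $\operatorname{Sym}(n)$-orbits that form the $j$-dimensional faces of the Stanley-Reisner complex $\Delta(I_n)$ is a polynomial in $n$ when $n$ is sufficiently large.
   Context: $\mathbb{N}$ denotes the positive integers. Fix $c\in\mathbb{N}$ and a field $\mathbf{k}$. Let $R_n=\mathbf{k}[x_{i,j}\mid i\in[c],j\in[n]]$, with $R_m\subseteq R_n$ for $m\le n$ and $\operatorname{Sym}(n)$ acting by $\sigma\cdot x_{i,j}=x_{i,\sigma(j)}$. A $\operatorname{Sym}$-invariant chain is a sequence of ideals $I_n\subseteq R_n$ with $\sigma(f)\in I_n$ for all $m\le n$, $f\in I_m$, $\sigma\in\operatorname{Sym}(n)$. The Stanley-Reisner complex $\Delta(I_n)$ of a squarefree monomial ideal $I_n$ is the simplicial complex on the set of variables of $R_n$ whose faces are the sets of variables whose product is a (squarefree) monomial not in $I_n$; a face with $j+1$ elements has dimension $j$. $\operatorname{Sym}(n)$ acts on the set of $j$-dimensional faces of $\Delta(I_n)$. *)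

(* Defs.v *)
From HB Require Import structures.
From mathcomp Require Import all_boot all_order all_algebra all_fingroup.
From mathcomp Require Import boolp classical_sets finmap.
From mathcomp.multinomials Require Import monalg.

Set Implicit Arguments.
Unset Strict Implicit.
Unset Printing Implicit Defensive.

Import GRing.Theory.

Local Open Scope ring_scope.
Local Open Scope classical_set_scope.

Definition var_index (c n : nat) : finType := ('I_c * 'I_n)%type.

Definition polyring (k : fieldType) (c n : nat) : comNzRingType :=
  {malg k[cmonom (var_index c n)]}.

Definition var (k : fieldType) (c n : nat) (v : var_index c n) :
    polyring k c n :=
  << 1 *g ucm v >>.

Definition rename_monomial (k : fieldType) (c m n : nat)
    (h : var_index c m -> var_index c n) (u : cmonom (var_index c m)) :
    polyring k c n :=
  \prod_(v : var_index c m) var k (h v) ^+ u v.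

(* The k-algebra morphism substituting the variable x_(h v) for each x_v. *)
Definition rename_vars (k : fieldType) (c m n : nat)
    (h : var_index c m -> var_index c n) :
    polyring k c m -> polyring k c n :=
  mmap (fun a : k => a%:MP) (@rename_monomial k c m n h).

Definition incl (k : fieldType) (c m n : nat) (le_mn : (m <= n)%N) :
    polyring k c m -> polyring k c n :=
  rename_vars (fun v => (v.1, widen_ord le_mn v.2)).

Definition var_act (c n : nat) (v : var_index c n) (s : 'S_n) :
    var_index c n :=
  (v.1, s v.2).

Lemma var_act1 (c n : nat) : @var_act c n ^~ 1%g =1 id.
Proof. by case=> i j; rewrite /var_act perm1. Qed.

Lemma var_actM (c n : nat) (v : var_index c n) :
  act_morph (@var_act c n) v.
Proof. by move=> s t; rewrite /var_act permM. Qed.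

(* MathComp actions are right actions, and (s * t) j = t (s j) in 'S_n; the
   orbits are those of the left action x_(i, j) |-> x_(i, s j). *)
Canonical var_action (c n : nat) := TotalAction (@var_act1 c n) (@var_actM c n).

Definition sym_act (k : fieldType) (c n : nat) (s : 'S_n) :
    polyring k c n -> polyring k c n :=
  rename_vars (fun v => var_act v s).

Definition is_ideal (R : comNzRingType) (I : set R) : Prop :=
  [/\ I 0,
      forall f g, I f -> I g -> I (f + g)
    & forall a f, I f -> I (a * f)].

(* The term of index 0 is junk: the chain starts at n = 1. *)
Definition sym_invariant_chain (k : fieldType) (c : nat)
    (I : forall n : nat, set (polyring k c n)) : Prop :=
  (forall n, (0 < n)%N -> is_ideal (I n)) /\
  (forall m n (le_mn : (m <= n)%N), (0 < m)%N ->
     forall (s : 'S_n) (f : polyring k c m),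
       I m f -> I n (sym_act s (incl le_mn f))).

Definition sqfree_monomial (k : fieldType) (c n : nat)
    (F : {set var_index c n}) : polyring k c n :=
  \prod_(v in F) var k v.

Definition sqfree_monomial_ideal (k : fieldType) (c n : nat)
    (I : set (polyring k c n)) : Prop :=
  exists S : set {set var_index c n},
    I = smallest (@is_ideal (polyring k c n))
                 [set sqfree_monomial k F | F in S].

(* The void complex when I is the unit ideal. *)
Definition stanley_reisner (k : fieldType) (c n : nat)
    (I : set (polyring k c n)) : {set {set var_index c n}} :=
  [set F | ~~ `[< I (sqfree_monomial k F) >]]%SET.

Definition faces (k : fieldType) (c n : nat) (I : set (polyring k c n))
    (j : nat) : {set {set var_index c n}} :=
  [set F in stanley_reisner I | #|F| == j.+1]%SET.

Definition face_orbit_number (k : fieldType) (c n : nat)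
    (I : set (polyring k c n)) (j : nat) : nat :=
  #|[set orbit (var_action c n)^*%act [set: 'S_n] F | F in faces I j]%SET|.

(* Main.v *)
(* The Sym(n)-orbit of a set F of variables records only how many columns of F
   have each given pattern, so for n > j no new orbits of (j+1)-sets appear:
   every (j+1)-set of variables of R_(n+1) has an empty column and can be moved
   into R_n. A nonface of Delta(I_n) stays a nonface in Delta(I_(n+1)), hence
   the number of orbits of j-faces is nonincreasing for n > j; it is eventually
   constant, and the polynomial is that constant. *)
Require Import Defs.
From mathcomp Require Import all_boot all_order all_algebra all_fingroup.
From mathcomp Require Import boolp classical_sets.
From mathcomp Require Import finmap.
From mathcomp.multinomials Require Import monalg.
Import GRing.Theory.

Local Open Scope ring_scope.

(** Induction on a strict upper bound [b] of [f m], with [m] varying: either [f] keeps the value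
    [f m] from [m] on, or it drops strictly at some [n] and the argument restarts there with a
    smaller bound. *)
Lemma nonincreasing_eventually_constant (f : nat -> nat) (m : nat) :
  (forall n, (m <= n)%N -> (f n.+1 <= f n)%N) ->
  exists (a N : nat), forall n, (N <= n)%N -> f n = a.
Proof.
move=> f_dec.
have f_homo n d : (m <= n)%N -> (f (n + d)%N <= f n)%N.
  move=> le_mn; elim: d => [|d IHd]; first by rewrite addn0.
  by rewrite addnS (leq_trans (f_dec _ _)) // (leq_trans le_mn) ?leq_addr.
have [b] := ubnP (f m); elim: b m f_dec f_homo => // b IHb m f_dec f_homo fm.
have [f_const|/existsNP[n /not_implyP[le_mn /eqP fn]]] :=
  pselect (forall n, (m <= n)%N -> f n = f m); first by exists (f m), m.
apply: (IHb n) => [p le_np|p d le_np|].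
- exact/f_dec/(leq_trans le_mn).
- exact/f_homo/(leq_trans le_mn).
- have := f_homo m (n - m)%N (leqnn m); rewrite subnKC // leq_eqVlt (negPf fn).
  by move=> /leq_trans; apply.
Qed.

Lemma sqfree_monomialE (k : fieldType) (c n : nat) (F : {set var_index c n}) :
  sqfree_monomial k F =
    << 1 *g \big[mul/one]_(v in F) ucm v >>.
Proof.
rewrite (big_morph (fun u => << 1 *g u >> : polyring k c n)
  (id1 := 1) (op1 := *%R)) // => u v.
by rewrite malgM_def fgmulUU mulr1.
Qed.

Lemma big_ucmE (c n : nat) (F : {set var_index c n}) (w : var_index c n) :
  (\big[mul/one]_(v in F) ucm v : cmonom _) w
    = (w \in F) :> nat.
Proof.
rewrite (big_morph (fun u : cmonom (var_index c n) => u w)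
  (fun a b => cmM w a b) (cm1 w)).
rewrite (eq_bigr (fun v => (v == w) : nat)) => [|v _]; last exact: ucmE.
rewrite big_mkcond (bigD1 w) //= big1 => [|v /negPf ->]; last by case: ifP.
by rewrite eqxx addn0; case: (w \in F).
Qed.

(** An injective renaming never merges two variables, so no exponent exceeds 1 and the image
    monomial is again squarefree. *)
Lemma rename_vars_sqfree (k : fieldType) (c m n : nat)
    (h : var_index c m -> var_index c n) (F : {set var_index c m}) :
  injective h ->
  rename_vars h (sqfree_monomial k F) = sqfree_monomial k (h @: F).
Proof.
move=> h_inj; rewrite sqfree_monomialE /rename_vars mmapE.
rewrite msuppU oner_eq0 big_seq_fset1 mcoeffUU mul1r /rename_monomial.
rewrite /sqfree_monomial big_imset /=; last by move=> ? ? _ _; apply: h_inj.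
rewrite [RHS]big_mkcond; apply: eq_bigr => v _.
by rewrite big_ucmE; case: (v \in F).
Qed.

Definition incl_var {c m n : nat} (le_mn : (m <= n)%N) (v : var_index c m) :
  var_index c n := (v.1, widen_ord le_mn v.2).

Lemma incl_var_inj (c m n : nat) (le_mn : (m <= n)%N) :
  injective (@incl_var c m n le_mn).
Proof. by case=> a b [a' b'] [-> /val_inj ->]. Qed.

Lemma var_act_inj (c n : nat) (s : 'S_n) :
  injective (fun v : var_index c n => var_act v s).
Proof. by case=> a b [a' b'] [-> /perm_inj ->]. Qed.

(** Contrapositive of the chain condition: if the monomial of [F] lies in [I m], its renamed image
    lies in [I n]. Both renamings are injective, so the dimension is kept. *)
Lemma face_incl (k : fieldType) (c : nat)
    (I : forall n : nat, set (polyring k c n)) (m n : nat)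
    (le_mn : (m <= n)%N) (s : 'S_n) (F : {set var_index c m}) (j : nat) :
  sym_invariant_chain I -> (0 < m)%N ->
  ((var_action c n)^*%act (incl_var le_mn @: F) s \in faces (I n) j) ->
  F \in faces (I m) j.
Proof.
move=> [_ chainI] m_gt0; rewrite !inE => /andP[Fs_face /eqP Fs_card].
move: Fs_card; rewrite card_imset; last exact: var_act_inj.
rewrite (card_imset _ (@incl_var_inj _ _ _ _)) => ->; rewrite eqxx andbT.
apply: contra Fs_face => /asboolP /(chainI _ _ le_mn m_gt0 s) IF.
apply/asboolP; move: IF; rewrite /incl rename_vars_sqfree; last first.
  exact: incl_var_inj.
by rewrite /sym_act rename_vars_sqfree //; apply: var_act_inj.
Qed.

(** A permutation of the first [n] columns extends to one fixing the last column, so inclusion sends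
    each orbit into a single orbit. *)
Lemma incl_var_setact (c n : nat) (s : 'S_n) (F : {set var_index c n}) :
  incl_var (leqnSn n) @: ((var_action c n)^*%act F s) =
  (var_action c n.+1)^*%act (incl_var (leqnSn n) @: F)
                            (lift_perm ord_max ord_max s).
Proof.
have widenE i : widen_ord (leqnSn n) i = lift ord_max i.
  by apply: val_inj; rewrite /= /bump leqNgt ltn_ord.
rewrite /= /setact -!imset_comp; apply: eq_imset => -[a b] /=.
by rewrite /incl_var /var_act /= !widenE lift_perm_lift.
Qed.

Lemma small_set_moved (c n : nat) (F : {set var_index c n.+1}) :
  (#|F| <= n)%N ->
  exists (s : 'S_n.+1) (G : {set var_index c n}),
    F = (var_action c n.+1)^*%act (incl_var (leqnSn n) @: G) s.
Proof.
move=> le_Fn.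
(* At most [n] elements cannot meet all [n.+1] columns; column [i] is empty. *)
have /subsetPn[i _ iF] : ~~ ([set: 'I_n.+1] \subset [set v.2 | v in F])%SET.
  apply: contraTN le_Fn => /subset_leq_card; rewrite cardsT card_ord -ltnNge.
  by move=> /leq_trans; apply; apply: leq_imset_card.
(* Swapping columns [i] and [ord_max] empties the last column; [G] is the swapped set read in the
   first [n] columns. The transposition, being its own inverse, also moves [G] back to [F]. *)
exists (tperm i ord_max), (incl_var (leqnSn n) @^-1:
  ((var_action c n.+1)^*%act F (tperm i ord_max))).
rewrite -[LHS](actKV (var_action c n.+1)^* (tperm i ord_max)) tpermV.
congr setact.
apply/eqP; rewrite finset.eqEsubset; apply/andP; split; last first.
  by apply/fintype.subsetP => _ /imsetP[v vF ->]; move: vF; rewrite inE.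
apply/fintype.subsetP => _ /imsetP[[a b] vF ->]; apply/imsetP.
have ltbn : (tperm i ord_max b < n)%N.
  rewrite ltn_neqAle -ltnS ltn_ord andbT; apply: contraNneq iF => b_max.
  apply/imsetP; exists (a, b) => //=; apply: (@perm_inj _ (tperm i ord_max)).
  by rewrite tpermL; apply: val_inj.
exists (a, Ordinal ltbn); last by congr pair; apply: val_inj.
rewrite inE /setact; apply/imsetP; exists (a, b) => //.
by congr pair; apply: val_inj.
Qed.

Lemma face_orbit_number_nonincreasing (k : fieldType) (c : nat)
    (I : forall n : nat, set (polyring k c n)) (j n : nat) :
  sym_invariant_chain I -> (j < n)%N ->
  (face_orbit_number (I n.+1) j <= face_orbit_number (I n) j)%N.
Proof.
move=> chainI lt_jn.
(* The bound on the number of orbits follows once the images under [up] of the face orbits at [n]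
   cover those at [n.+1]. Some of these images may consist of nonfaces. Orbits are nonempty, so the
   default [finset.set0] never matters for them. *)
pose up (O : {set {set var_index c n}}) :=
  orbit (var_action c n.+1)^* [set: 'S_n.+1]
    (incl_var (leqnSn n) @: odflt finset.set0 [pick F in O]).
apply: leq_trans (leq_imset_card up _); apply/subset_leq_card/fintype.subsetP.
move=> _ /imsetP[F F_face ->].
have F_card : (#|F| <= n)%N.
  by move: F_face; rewrite inE => /andP[_ /eqP ->].
have [s [G FE]] := small_set_moved _ _ _ F_card.
have G_face : G \in faces (I n) j.
  apply: (@face_incl _ _ _ _ _ (leqnSn n) s) => //; last by rewrite -FE.
  exact: leq_ltn_trans lt_jn.
apply/imsetP; exists (orbit (var_action c n)^* [set: 'S_n] G).
  by apply/imsetP; exists G.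
(* The chosen representative [G'] is only a translate of [G] by some [t]; extending [t] to [n.+1]
   columns shows that both give the orbit of [F]. *)
rewrite /up; case: pickP => [G' /orbitP[t _ <-]|/(_ G)]; last first.
  by rewrite orbit_refl.
rewrite /= FE incl_var_setact !orbit_act //; exact: finset.in_setT.
Qed.

Theorem theorem9p2 (k : fieldType) (c : nat) (c_gt0 : (0 < c)%N)
    (I : forall n : nat, set (polyring k c n))
    (chainI : sym_invariant_chain I)
    (sqfreeI : forall n : nat, (0 < n)%N -> sqfree_monomial_ideal (I n))
    (j : nat) :
  exists (p : {poly rat}) (N : nat), forall n : nat, (0 < n)%N -> (N <= n)%N ->
    (face_orbit_number (I n) j)%:R = p.[n%:R].
Proof.
have [a [N fE]] := nonincreasing_eventually_constant
  (fun n => face_orbit_number (I n) j) j.+1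
  (fun n => @face_orbit_number_nonincreasing k c I j n chainI).
by exists (a%:R%:P), N => n _ /fE /= ->; rewrite hornerC.
Qed.
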